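(* Let $2\le n\le N$, $i\in\{1,\dots,r_n\}$, $j\in\{1,\dots,r_{n-1}\}$, and let $\rho_n=k_n/k_{n-1}$. Then $$\mathcal{A}^{n1}_j=(1+\rho_n)^{1-\alpha}\int_{-1}^1(2\rho_n+1-\sigma)^{\alpha-1}\Psi_{n-1,j}(\sigma)\,d\sigma,$$ $$\mathcal{B}^{n1}_j=(1+\rho_n)^{1-\alpha}\int_{-1}^1(1-\sigma)^{\alpha-1}\Psi_{n-1,j}(\sigma)\,d\sigma$$ and $$\mathcal{C}^{n1}_{ij}=(1+\rho_n)^{1-\alpha}\biggl(\int_{-1}^1(1+\tau)^\alpha\Psi'_{ni}(\tau)\int_0^1(\rho_n+z)^{\alpha-1}\Psi_{n-1,j}\bigl(1-z(1+\tau)\bigr)\,dz\,d\tau$$ $$\qquad\qquad{}+\int_{-1}^1(1-\sigma)^\alpha\Psi_{n-1,j}(\sigma)\int_0^1(\rho_nz+1)^{\alpha-1}\Psi_{ni}'\bigl(z(1-\sigma)-1\bigr)\,dz\,d\sigma\biggr).$$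
   Context: Fix $0<\alpha<1$. Let $0=t_0<t_1<\cdots<t_N=T$ be a grid, $k_n=t_n-t_{n-1}$ and $I_n=(t_{n-1},t_n)$. For integers $r_1,\dots,r_N\ge1$ and each $1\le n\le N$, let $\psi_{n1},\dots,\psi_{nr_n}$ be a basis of $\mathbb{P}_{r_n-1}$, the space of real polynomials of degree at most $r_n-1$. Define $\mathsf{t}_n:[-1,1]\to[t_{n-1},t_n]$ by $\mathsf{t}_n(\tau)=\tfrac12[(1-\tau)t_{n-1}+(1+\tau)t_n]$ and set $\Psi_{nj}(\tau)=\psi_{nj}(\mathsf{t}_n(\tau))$ for $-1\le\tau\le1$. For $1\le\ell\le n-1$ write $\bar\ell=n-\ell$ (superscripts and subscripts $n\bar\ell$ mean the pair $(n,\bar\ell)$), let $t_{n-1/2}=\tfrac12(t_{n-1}+t_n)$, and put $$D_{n\bar\ell}=t_{n-1/2}-t_{\ell-1/2},\qquad \Delta_{n\bar\ell}(\tau,\sigma)=\frac{\tau k_n-\sigma k_\ell}{2D_{n\bar\ell}},$$ $$\mathcal{A}^{n\bar\ell}_j=\int_{-1}^1\bigl(1+\Delta_{n\bar\ell}(1,\sigma)\bigr)^{\alpha-1}\Psi_{\ell j}(\sigma)\,d\sigma,\qquad \mathcal{B}^{n\bar\ell}_j=\int_{-1}^1\bigl(1+\Delta_{n\bar\ell}(-1,\sigma)\bigr)^{\alpha-1}\Psi_{\ell j}(\sigma)\,d\sigma,$$ $$\mathcal{C}^{n\bar\ell}_{ij}=\int_{-1}^1\Psi_{ni}'(\tau)\int_{-1}^1\bigl(1+\Delta_{n\bar\ell}(\tau,\sigma)\bigr)^{\alpha-1}\Psi_{\ell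 j}(\sigma)\,d\sigma\,d\tau .$$ Thus $\mathcal{A}^{n1}_j$, $\mathcal{B}^{n1}_j$, $\mathcal{C}^{n1}_{ij}$ are the case $\bar\ell=1$, i.e. $\ell=n-1$. *)

(* Defs.v *)
From mathcomp Require Import all_boot all_order all_algebra.
From mathcomp Require Import all_classical all_reals all_analysis.

Set Implicit Arguments.
Unset Strict Implicit.
Unset Printing Implicit Defensive.

Import Order.TTheory GRing.Theory Num.Theory.
Import numFieldNormedType.Exports.

Local Open Scope classical_set_scope.
Local Open Scope ring_scope.

(* A grid is a sequence t : nat -> R of which only t 0, ..., t N matter, and the
   family psi n, of r n polynomials, only matters for 1 <= n <= N.  As
   {poly_n R} bounds the size, {poly_(r n) R} is the space of polynomials of
   degree at most r n - 1.  The basis index is 0-based, i.e., in 'I_(r n). *)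

Section TimeGrid.
Context {R : realType}.
Implicit Types (t : nat -> R) (r : nat -> nat) (n lb : nat) (tau sigma : R).

Definition step t n : R := t n - t n.-1.

Definition midpoint t n : R := (t n.-1 + t n) / 2.

Definition tmap t n tau : R := ((1 - tau) * t n.-1 + (1 + tau) * t n) / 2.

Definition Psi t r (psi : forall n, (r n).-tuple {poly_(r n) R}) n
    (j : 'I_(r n)) tau : R :=
  (polyn (tnth (psi n) j)).[tmap t n tau].
Arguments Psi t {r} psi n j tau.

(* Below, lb is the distance n - l between the indices of the two subintervals,
   so that l = n - lb.  For lb = 1 the kernel is singular at sigma = 1 in calB
   and at (tau, sigma) = (-1, 1) in calC, but integrable, because alpha > 0; the
   convention 0 `^ (alpha - 1) = 0 only affects null sets. *)

Definition Dmid t n lb : R := midpoint t n - midpoint t (n - lb)%N.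

Definition Delta t n lb tau sigma : R :=
  (tau * step t n - sigma * step t (n - lb)%N) / (2 * Dmid t n lb).

Definition calA (alpha : R) t r (psi : forall n, (r n).-tuple {poly_(r n) R})
    n lb (j : 'I_(r (n - lb)%N)) : R :=
  \int[lebesgue_measure]_(sigma in `[-1, 1])
    ((1 + Delta t n lb 1 sigma) `^ (alpha - 1) *
     Psi t psi (n - lb)%N j sigma).

Definition calB (alpha : R) t r (psi : forall n, (r n).-tuple {poly_(r n) R})
    n lb (j : 'I_(r (n - lb)%N)) : R :=
  \int[lebesgue_measure]_(sigma in `[-1, 1])
    ((1 + Delta t n lb (-1) sigma) `^ (alpha - 1) *
     Psi t psi (n - lb)%N j sigma).

Definition calC (alpha : R) t r (psi : forall n, (r n).-tuple {poly_(r n) R})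
    n lb (i : 'I_(r n)) (j : 'I_(r (n - lb)%N)) : R :=
  \int[lebesgue_measure]_(tau in `[-1, 1])
    (derive1 (Psi t psi n i) tau *
     \int[lebesgue_measure]_(sigma in `[-1, 1])
       ((1 + Delta t n lb tau sigma) `^ (alpha - 1) *
        Psi t psi (n - lb)%N j sigma)).

End TimeGrid.

Arguments Psi {R} t {r} psi n j tau.
Arguments calA {R} alpha t {r} psi n lb j.
Arguments calB {R} alpha t {r} psi n lb j.
Arguments calC {R} alpha t {r} psi n lb i j.

(* Main.v *)
Require Import Defs.
From mathcomp Require Import all_boot all_order all_algebra.
From mathcomp Require Import all_classical all_reals all_analysis.
From mathcomp Require Import measurable_realfun ring lra.

(** Write k and k' for the lengths of the n-th and (n-1)-st subintervals, and
rho = k / k'.  As these intervals are adjacent, twice the distance between their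
midpoints is k + k', which turns the kernel into
[[
  1 + Delta(tau, sigma) = (rho (1 + tau) + (1 - sigma)) / (1 + rho).
]]
The base is nonnegative on the square, so the factor (1 + rho)^(1 - alpha) comes
out of the power; with tau = 1 and tau = -1 this is already the formula for the
first two integrals.

The third integrand is K(tau, sigma) p(tau) q(sigma), for continuous p and q and
K = (rho (1 + tau) + (1 - sigma))^(alpha - 1), which is singular only at the
corner (-1, 1).  Its integral is computed by Duffy's transformation
([Rintegral_Duffy]).  Cut the square along the diagonal tau + sigma = 0 through
the singular corner.  In the triangle 1 - sigma <= 1 + tau, put
1 - sigma = z (1 + tau); in the other one, put 1 + tau = z (1 - sigma).  As K is
homogeneous of degree alpha - 1 in (1 + tau, 1 - sigma), the Jacobian of either
substitution raises the power of the distance to alpha, and what is left of K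
is a regular function of z.

In the second triangle the substitution is made in tau, so that the order of
integration must be exchanged first.  This is Fubini's theorem, and the same
homogeneity gives the integrability which it requires: in the first triangle K
is at most (rho (1 + tau))^(alpha - 1) on the slice at tau, of length 1 + tau,
so that its integral over the slice is bounded by a constant times
(1 + tau)^alpha; likewise for the slices at sigma in the second triangle.
Bounded slices are enough ([integrable_bounded_slices1] and
[integrable_bounded_slices2]), so that no improper integral is ever computed.

Constants are taken out of integrals by [RintegralZl_nonmeasurable], which asks
for no integrability of the singular integrands. *)

Set Implicit Arguments.
Unset Strict Implicit.
Unset Printing Implicit Defensive.

Import Order.TTheory GRing.Theory Num.Theory.
Import numFieldNormedType.Exports.

Local Open Scope classical_set_scope.
Local Open Scope ring_scope.

(** * Constants in integrals of arbitrary functions *)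

Section integral_scaling.
Context d (T : measurableType d) (R : realType).
Variable mu : {measure set T -> \bar R}.
Implicit Types (f : T -> R) (D : set T) (c : R).

Import HBNNSimple.

Let ge0_integralZl_le (c : R) (f : T -> \bar R) : 0 < c ->
  (forall x, 0 <= f x)%E ->
  (c%:E * \int[mu]_x f x <= \int[mu]_x (c%:E * f x))%E.
Proof.
move=> c0 f0; rewrite !ge0_integralTE//; last first.
  by move=> x; rewrite mule_ge0// lee_fin ltW.
rewrite -ereal_sup_pZl//; apply: ge_ereal_sup => _ [_ [h hf <-] <-].
apply: ereal_sup_ubound; exists (scale_nnsfun h (ltW c0)) => /=.
  by move=> x; rewrite EFinM; apply: lee_wpmul2l; rewrite ?lee_fin// ltW.
by rewrite -sintegralrM.
Qed.

Let ge0_integralZl_nonmeasurable (c : R) (f : T -> \bar R) : 0 < c ->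
  (forall x, 0 <= f x)%E ->
  (\int[mu]_x (c%:E * f x) = c%:E * \int[mu]_x f x)%E.
Proof.
move=> c0 f0; apply/eqP; rewrite eq_le ge0_integralZl_le// andbT.
have cV0 : 0 < c^-1 by rewrite invr_gt0.
have cf0 x : (0 <= c%:E * f x)%E by rewrite mule_ge0// lee_fin ltW.
have := ge0_integralZl_le cV0 cf0.
under [X in (_ <= X)%E -> _]eq_integral => x _.
  rewrite muleA -EFinM mulVf ?gt_eqF// mul1e; over.
by rewrite lee_pdivrMl.
Qed.

Let RintegralN f : \int[mu]_x (- f x) = - \int[mu]_x f x.
Proof.
have fineBC (x y : \bar R) : fine (x - y)%E = - fine (y - x)%E.
  by case: x y => [x| |] [y| |] //=; rewrite ?oppr0// opprB.
rewrite /Rintegral integralE [in RHS]integralE -fineBC.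
by rewrite -[fun x => (- f x)%:E]/(\- (EFin \o f))%E funeposN funenegN.
Qed.

Let gt0_RintegralZl_nonmeasurable (c : R) f : 0 < c ->
  \int[mu]_x (c * f x) = c * \int[mu]_x f x.
Proof.
move=> c0; have fineZl (x y : \bar R) :
    fine (c%:E * x - c%:E * y)%E = c * fine (x - y)%E.
  have cy : (c%:E * +oo = +oo)%E by rewrite gt0_muley// lte_fin.
  have cNy : (c%:E * -oo = -oo)%E by rewrite gt0_muleNy// lte_fin.
  by case: x y => [x| |] [y| |] /=; rewrite ?cy ?cNy /= ?mulr0// mulrBr.
rewrite /Rintegral integralE [in RHS]integralE -fineZl.
rewrite -[fun x => (c * f x)%:E]/(fun x => c%:E * (EFin \o f) x)%E.
rewrite ge0_funeposM ?ge0_funenegM ?ltW//.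
by rewrite !ge0_integralZl_nonmeasurable.
Qed.

(** The integral is defined for every function, as a difference of two suprema
over simple functions, and each supremum is homogeneous.  If both are infinite,
or only one, then the real-valued integral is 0 on either side. *)
Lemma RintegralZl_nonmeasurable c f D :
  \int[mu]_(x in D) (c * f x) = c * \int[mu]_(x in D) f x.
Proof.
rewrite !(Rintegral_mkcond _ D).
have -> : (fun x => c * f x) \_ D = fun x => c * (f \_ D) x.
  by apply/funext => x; rewrite !patchE; case: ifPn; rewrite ?mulr0.
have [c0|c0|<-] := ltgtP 0 c; first exact: gt0_RintegralZl_nonmeasurable.
- rewrite -[RHS]opprK -mulNr -gt0_RintegralZl_nonmeasurable ?oppr_gt0//.
  by rewrite -RintegralN; under [RHS]eq_Rintegral do rewrite mulNr opprK.
- rewrite mul0r; under eq_Rintegral do rewrite mul0r.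
  by rewrite /Rintegral integral0.
Qed.

End integral_scaling.

(** * Affine substitution onto the unit interval *)

Section unit_interval.
Context {R : realType}.
Notation mu := (@lebesgue_measure R).
Implicit Types (f G : R -> R) (c d : R).

Lemma Rintegral_unit_itv c d G : 0 < c ->
  {within `[d, d + c], continuous G} ->
  \int[mu]_(x in `[d, d + c]) G x = c * \int[mu]_(z in `[0, 1]) G (d + z * c).
Proof.
move=> c0 cG; pose F (z : R) := d + z * c.
have dF (z : R) : is_derive z 1 F c.
  by apply: trigger_derive; rewrite /GRing.scale/=; ring.
have F'E : F^`()%classic = cst c.
  by apply/funext => z; rewrite derive1E derive_val.
have cF : continuous F.
  by move=> z; apply/differentiable_continuous/derivable1_diffP.
have F0 : F 0 = d by rewrite /F mul0r addr0.
have F1 : F 1 = d + c by rewrite /F mul1r.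
rewrite -RintegralZl_nonmeasurable /Rintegral -F1 -{1}F0.
rewrite (@integration_by_substitution_increasing _ F G 0 1) ?ler01//.
- by congr fine; apply: eq_integral => z _; rewrite !fctE F'E/= mulrC.
- by move=> x y _ _ xy; rewrite ltrD2l ltr_pM2r.
- by rewrite F'E => ? _; exact: cvg_cst.
- by rewrite F'E; exact: is_cvg_cst.
- by rewrite F'E; exact: is_cvg_cst.
- by split => //; [exact/cvg_at_right_filter/cF|exact/cvg_at_left_filter/cF].
- by rewrite F0 F1.
Qed.

Lemma Rintegral_unit_itvN c d G : 0 < c ->
  {within `[d - c, d], continuous G} ->
  \int[mu]_(x in `[d - c, d]) G x = c * \int[mu]_(z in `[0, 1]) G (d - z * c).
Proof.
move=> c0 cG; pose F (z : R) := d - z * c.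
have dF (z : R) : is_derive z 1 F (- c).
  by apply: trigger_derive; rewrite /GRing.scale/=; ring.
have F'E : F^`()%classic = cst (- c).
  by apply/funext => z; rewrite derive1E derive_val.
have cF : continuous F.
  by move=> z; apply/differentiable_continuous/derivable1_diffP.
have F0 : F 0 = d by rewrite /F mul0r subr0.
have F1 : F 1 = d - c by rewrite /F mul1r.
rewrite -RintegralZl_nonmeasurable /Rintegral -F1 -{1}F0.
rewrite (@integration_by_substitution_decreasing _ F G 0 1) ?ler01//.
- by congr fine; apply: eq_integral => z _; rewrite !fctE F'E/= opprK mulrC.
- by move=> x y _ _ xy; rewrite ltrD2l ltrN2 ltr_pM2r.
- by rewrite F'E => ? _; exact: cvg_cst.
- by rewrite F'E; exact: is_cvg_cst.
- by rewrite F'E; exact: is_cvg_cst.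
- by split => //; [exact/cvg_at_right_filter/cF|exact/cvg_at_left_filter/cF].
- by rewrite F0 F1.
Qed.

End unit_interval.

(** * Fubini's theorem for real-valued integrals *)

Section real_Fubini.
Context d1 d2 (T1 : measurableType d1) (T2 : measurableType d2) (R : realType).
Variables (m1 : {sigma_finite_measure set T1 -> \bar R}).
Variables (m2 : {sigma_finite_measure set T2 -> \bar R}).

Let integrable_fine d (T : measurableType d) (mu : {measure set T -> \bar R})
    (F : T -> \bar R) :
  mu.-integrable setT F -> mu.-integrable setT (fun x => (fine (F x))%:E).
Proof.
move=> iF; apply: le_integrable (iF) => //.
  apply/measurable_EFinP/measurableT_comp => //; exact: measurable_int iF.
by move=> x _; case: (F x) => [r| |] //=; rewrite normr0 leey.
Qed.

Let integral_fine d (T : measurableType d) (mu : {measure set T -> \bar R})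
    (F : T -> \bar R) : mu.-integrable setT F ->
  \int[mu]_x fine (F x) = fine (\int[mu]_x F x)%E.
Proof.
move=> iF; congr fine; apply: ae_eq_integral => //.
- exact: measurable_int (integrable_fine iF).
- exact: measurable_int iF.
- have := integrable_ae measurableT iF; apply: filterS => x /(_ Logic.I) Fx _.
  by rewrite fineK.
Qed.

Variable f : T1 * T2 -> R.
Hypothesis fi : (m1 \x m2)%E.-integrable setT (EFin \o f).

Let integrable_fubini_G : m2.-integrable setT (fubini_G m1 (EFin \o f)).
Proof.
have mf : measurable_fun setT (EFin \o f) by exact: measurable_int fi.
apply/integrableP; split; first exact: (measurable_fubini_G fi).
apply: le_lt_trans ((integrable21ltyP _ _ mf).1 fi).
apply: ge0_le_integral => //.
- exact/measurableT_comp/(measurable_fubini_G fi).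
- apply: (measurable_fun_fubini_tonelli_G (fun z => `|(EFin \o f) z|%E)) => //.
  exact: measurableT_comp.
- move=> y _; apply: le_abse_integral => //.
  exact/(measurable_fun_pair1 y mf).
Qed.

(** Some slices may fail to be integrable, and their integral is then a default
value, but they are harmless: the extended integral of a slice is finite almost
everywhere. *)
Lemma integrable_Rintegral_prod1 :
  m1.-integrable setT (EFin \o (fun x => \int[m2]_y f (x, y))).
Proof. exact: integrable_fine (integrable_fubini_F fi). Qed.

Lemma Rintegral_Fubini :
  \int[m1]_x \int[m2]_y f (x, y) = \int[m2]_y \int[m1]_x f (x, y).
Proof.
rewrite (integral_fine (integrable_fubini_F fi)).
by rewrite (integral_fine integrable_fubini_G) -(Fubini fi).
Qed.

End real_Fubini.

Section bounded_slices.
Context {R : realType}.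
Notation mu := (@lebesgue_measure R).
Implicit Types (f : R * R -> R) (g : R -> R).

Let integrable_bounded_itv (F : R -> \bar R) (a b C : R) : (a <= b)%R ->
  measurable_fun setT F ->
  (forall x, 0 <= F x <= (C * \1_`[a, b] x)%:E)%E ->
  (\int[mu]_x F x <= (C * (b - a))%:E)%E.
Proof.
move=> ab mF bF; have mC : measurable_fun setT
    (fun x => (C * \1_(`[a, b] : set R) x)%:E).
  by apply/measurable_EFinP/measurable_funM => //; exact: measurable_indic.
apply: (@le_trans _ _ (\int[mu]_x (C * \1_`[a, b] x)%:E)%E).
  by apply: ge0_le_integral => // x _; have /andP[] := bF x.
have C0 : 0 <= C.
  have /andP[/le_trans /[apply]] := bF a.
  by rewrite lee_fin indicE mem_set ?mulr1//= in_itv/= lexx.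
under eq_integral do rewrite EFinM.
rewrite ge0_integralZl//=; last first.
  by apply/measurable_EFinP; exact: measurable_indic.
rewrite integral_indic//= setIT lebesgue_measure_itv/= lte_fin.
case: ltP => [_|ba]; first by rewrite -EFinB -EFinM.
by rewrite mule0 lee_fin mulr_ge0// subr_ge0.
Qed.

(** If the slices at x outside [a, b] vanish, and the others have an absolute
integral at most C, then Tonelli's theorem bounds the absolute double integral
by C (b - a).  The slice at x is bounded by B x and lives on [u x, v x]: the
bound B may blow up, provided that the length of the slice compensates. *)
Lemma integrable_bounded_slices1 f (u v B : R -> R) (a b C : R) :
  a <= b -> measurable_fun setT f ->
  (forall x, x \notin `[a, b] -> forall y, f (x, y) = 0) ->
  {in `[a, b], forall x, u x <= v x} ->
  {in `[a, b], forall x y, `|f (x, y)| <= B x * \1_`[u x, v x] y} ->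
  {in `[a, b], forall x, B x * (v x - u x) <= C} ->
  (mu \x mu)%E.-integrable setT (EFin \o f).
Proof.
move=> ab mf f0 uv fB BC.
have mef : measurable_fun setT (EFin \o f) by exact/measurable_EFinP.
apply: (integrable12ltyP mu mu mef).2.
apply: le_lt_trans (ltry (C * (b - a))); apply: integrable_bounded_itv => //.
  apply: (@measurable_fun_fubini_tonelli_F _ _ _ _ R mu
    (fun z => `|(EFin \o f) z|%E)) => //.
  exact: measurableT_comp.
move=> x; rewrite integral_ge0//= indicE mem_setE.
have [xab|xab] := boolP (x \in `[a, b]).
  apply: (le_trans _ (_ : (B x * (v x - u x))%:E <= _)%E); last first.
    by rewrite mulr1 lee_fin BC.
  apply: integrable_bounded_itv; [exact: uv| |].
    apply/measurable_EFinP/measurableT_comp => //.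
    exact: (measurable_fun_pair2 x mf).
  by move=> y; rewrite lee_fin normr_ge0 lee_fin/= fB.
under eq_integral do rewrite f0 ?normr0//.
by rewrite integral0 mulr0.
Qed.

Lemma integrable_bounded_slices2 f (u v B : R -> R) (a b C : R) :
  a <= b -> measurable_fun setT f ->
  (forall y, y \notin `[a, b] -> forall x, f (x, y) = 0) ->
  {in `[a, b], forall y, u y <= v y} ->
  {in `[a, b], forall y x, `|f (x, y)| <= B y * \1_`[u y, v y] x} ->
  {in `[a, b], forall y, B y * (v y - u y) <= C} ->
  (mu \x mu)%E.-integrable setT (EFin \o f).
Proof.
move=> ab mf f0 uv fB BC.
have mef : measurable_fun setT (EFin \o f) by exact/measurable_EFinP.
apply: (integrable21ltyP mu mu mef).2.
apply: le_lt_trans (ltry (C * (b - a))); apply: integrable_bounded_itv => //.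
  apply: (@measurable_fun_fubini_tonelli_G _ _ _ _ R mu
    (fun z => `|(EFin \o f) z|%E)) => //.
  exact: measurableT_comp.
move=> y; rewrite integral_ge0//= indicE mem_setE.
have [yab|yab] := boolP (y \in `[a, b]).
  apply: (le_trans _ (_ : (B y * (v y - u y))%:E <= _)%E); last first.
    by rewrite mulr1 lee_fin BC.
  apply: integrable_bounded_itv; [exact: uv| |].
    apply/measurable_EFinP/measurableT_comp => //.
    exact: (measurable_fun_pair1 y mf).
  by move=> x; rewrite lee_fin normr_ge0 lee_fin/= fB.
under eq_integral do rewrite f0 ?normr0//.
by rewrite integral0 mulr0.
Qed.

End bounded_slices.

(** * Powers and bounds *)

Section powR_extra.
Context {R : realType}.
Implicit Types (a x y : R) (f : R -> R).

Lemma le0_ger_powR a x y : a <= 0 -> 0 < x -> x <= y -> y `^ a <= x `^ a.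
Proof.
move=> a0 x0 xy; have y0 := lt_le_trans x0 xy.
rewrite -[a]opprK !(powRN _ (- a)) lef_pV2 ?posrE ?powR_gt0//.
by apply: ge0_ler_powR; rewrite ?oppr_ge0// ?nnegrE ltW.
Qed.

Lemma continuous_powR a x f : 0 < f x ->
  {for x, continuous f} -> {for x, continuous (fun y => f y `^ a)}.
Proof.
move=> fx0 cf.
apply: (@continuous_comp _ _ _ f (fun y => y `^ a) x cf).
apply/differentiable_continuous/derivable1_diffP.
by apply: derivable_powR; rewrite in_itv/= fx0.
Qed.

Lemma continuous_itv_bounded f (u v : R) : u <= v -> continuous f ->
  exists2 M, 0 <= M & {in `[u, v], forall x, `|f x| <= M}.
Proof.
move=> uv cf; have cnf : {within `[u, v], continuous (fun x => `|f x|)}.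
  by apply: continuous_subspaceT => x; exact: cvg_norm (cf x).
have [c _ fc] := EVT_max uv cnf.
by exists (`|f c|).
Qed.

End powR_extra.

(** * Duffy's transformation for the corner singularity *)

Section singular_kernel.
Context {R : realType}.
Notation mu := (@lebesgue_measure R).
Variables (alpha rho : R) (p q : R -> R).
Hypotheses (alpha_gt0 : 0 < alpha) (alpha_le1 : alpha <= 1) (rho_gt0 : 0 < rho).
Hypotheses (cp : continuous p) (cq : continuous q).

Let K (x y : R) := (rho * (1 + x) + (1 - y)) `^ (alpha - 1).

Let base_gt0l (x y : R) : -1 < x -> y <= 1 -> 0 < rho * (1 + x) + (1 - y).
Proof.
by move=> x1 y1; rewrite ltr_pwDl ?subr_ge0// mulr_gt0// -ltrBlDl sub0r.
Qed.

Let base_gt0r (x y : R) : -1 <= x -> y < 1 -> 0 < rho * (1 + x) + (1 - y).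
Proof.
move=> x1 y1; rewrite ltr_wpDl ?subr_gt0// mulr_ge0 ?(ltW rho_gt0)//.
by rewrite -lerBlDl sub0r.
Qed.

Let continuous_slice1 (u x : R) : -1 < x ->
  {within `[u, 1], continuous (fun y => K x y * q y)}.
Proof.
move=> x1; apply: continuous_in_subspaceT => y /set_mem; rewrite /= in_itv/=.
move=> /andP[_ y1]; apply: cvgM; last exact: cq.
apply: (@continuous_powR _ _ _ (fun y => rho * (1 + x) + (1 - y))).
  exact: base_gt0l.
by apply: cvgD; [exact: cvg_cst|apply: cvgB; [exact: cvg_cst|exact: cvg_id]].
Qed.

Let continuous_slice2 (v y : R) : y < 1 ->
  {within `[-1, v], continuous (fun x => K x y * p x)}.
Proof.
move=> y1; apply: continuous_in_subspaceT => x /set_mem; rewrite /= in_itv/=.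
move=> /andP[x1 _]; apply: cvgM; last exact: cp.
apply: (@continuous_powR _ _ _ (fun x => rho * (1 + x) + (1 - y))).
  exact: base_gt0r.
apply: cvgD; last exact: cvg_cst.
by apply: cvgM; [exact: cvg_cst|apply: cvgD; [exact: cvg_cst|exact: cvg_id]].
Qed.

(** The substitution y = 1 - z (1 + x) on one slice: the Jacobian 1 + x meets
the factor (1 + x)^(alpha - 1) of the homogeneous kernel. *)
Let scaled_slice1 (x : R) : -1 < x ->
  \int[mu]_(y in `[- x, 1]) (K x y * q y) =
  (1 + x) `^ alpha *
  \int[mu]_(z in `[0, 1]) ((rho + z) `^ (alpha - 1) * q (1 - z * (1 + x))).
Proof.
move=> x1; have x10 : 0 < 1 + x by rewrite -ltrBlDl sub0r.
have -> : - x = 1 - (1 + x) by ring.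
have cK := @continuous_slice1 (1 - (1 + x)) x x1.
rewrite (Rintegral_unit_itvN x10 cK).
rewrite -(mulr_powRB1 (ltW x10) alpha_gt0) -mulrA -!RintegralZl_nonmeasurable.
apply: eq_Rintegral => z /set_mem /=; rewrite in_itv/= => /andP[z0 _].
rewrite /K; have -> : rho * (1 + x) + (1 - (1 - z * (1 + x))) =
  (1 + x) * (rho + z) by ring.
by rewrite powRM ?mulrA// ?(ltW x10)// addr_ge0// ltW.
Qed.

Let scaled_slice2 (y : R) : y < 1 ->
  \int[mu]_(x in `[-1, - y]) (K x y * p x) =
  (1 - y) `^ alpha *
  \int[mu]_(z in `[0, 1]) ((rho * z + 1) `^ (alpha - 1) * p (z * (1 - y) - 1)).
Proof.
move=> y1; have y10 : 0 < 1 - y by rewrite subr_gt0.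
rewrite [in LHS](_ : - y = -1 + (1 - y)); last by ring.
have cK := @continuous_slice2 (-1 + (1 - y)) y y1.
rewrite (Rintegral_unit_itv y10 cK).
rewrite -(mulr_powRB1 (ltW y10) alpha_gt0) -mulrA -!RintegralZl_nonmeasurable.
apply: eq_Rintegral => z /set_mem /=; rewrite in_itv/= => /andP[z0 _].
rewrite /K; have -> : rho * (1 + (-1 + z * (1 - y))) + (1 - y) =
  (1 - y) * (rho * z + 1) by ring.
rewrite powRM ?(ltW y10)// ?addr_ge0 ?mulr_ge0 ?(ltW rho_gt0)//.
by rewrite !mulrA [-1 + _]addrC.
Qed.

(** The integrand on the part of the square where x + y lies in I; the two
triangles are I = [0, +oo[ and I = ]-oo, 0[.  The edge x = -1, a null
set, is left out: the slice K(-1, y) = (1 - y)^(alpha - 1) may be unbounded. *)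
Let h (I : set R) (z : R * R) : R :=
  \1_(`]-1, 1] : set R) z.1 * (\1_(`[-1, 1] : set R) z.2 *
  (\1_I (z.1 + z.2) * (p z.1 * (K z.1 z.2 * q z.2)))).

Let measurable_h (I : set R) : measurable I -> measurable_fun setT (h I).
Proof.
move=> mI; have mfst : measurable_fun setT (@fst R R) by exact: measurable_fst.
have msnd : measurable_fun setT (@snd R R) by exact: measurable_snd.
have mp := continuous_measurable_fun cp.
have mq := continuous_measurable_fun cq.
rewrite /h /K; apply: measurable_funM.
  by apply: measurableT_comp mfst; exact: measurable_indic.
apply: measurable_funM.
  by apply: measurableT_comp msnd; exact: measurable_indic.
apply: measurable_funM.
  apply: (measurableT_comp (measurable_indic _)) => //.
  exact: measurable_funD.
apply: measurable_funM; first exact: measurableT_comp mfst.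
apply: measurable_funM; last exact: measurableT_comp msnd.
apply: (measurableT_comp (@measurable_powR R (alpha - 1))).
apply: measurable_funD; last exact: measurable_funB.
by apply: measurable_funM => //; exact: measurable_funD.
Qed.

(** The slice at x is bounded by a multiple of (rho (1 + x))^(alpha - 1) on the
segment [- x, 1], of length 1 + x, so its integral is O((1 + x)^alpha). *)
Let integrable_h_ge0 : (mu \x mu)%E.-integrable setT (EFin \o h `[0, +oo[).
Proof.
have ab : -1 <= 1 :> R by lra.
have [Mp Mp0 pM] := continuous_itv_bounded ab cp.
have [Mq Mq0 qM] := continuous_itv_bounded ab cq.
pose B (x : R) := Mp * Mq * (rho * (1 + x)) `^ (alpha - 1).
have B0 x : 0 <= B x by rewrite !mulr_ge0// powR_ge0.
apply: (@integrable_bounded_slices1 _ _ (fun x => - x) (fun=> 1) B (-1) 1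
  (Mp * Mq * rho `^ (alpha - 1) * 2 `^ alpha)) => //.
- exact: measurable_h.
- move=> x; rewrite in_itv/= => /negP x1 y.
  rewrite /h/= indicE mem_setE in_itv/=.
  by case: andP => [[]|]; rewrite ?mul0r// => /ltW xm xM; case: x1; rewrite xm.
- by move=> x; rewrite in_itv/=; lra.
- move=> x; rewrite in_itv/= => /andP[x1 x2] y.
  rewrite /h/= !indicE !mem_setE !in_itv/= andbT.
  have [xm|] := ltP (-1) x; last by rewrite mul0r normr0 mulr_ge0.
  have [xy|xy] := leP 0 (x + y); last by rewrite mul0r !mulr0 normr0 mulr_ge0.
  have [y2|] := leP y 1; last by rewrite andbF mul0r mulr0 normr0 mulr_ge0.
  have y1 : -1 <= y by lra.
  rewrite x2 y1 (_ : - x <= y); last by lra.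
  rewrite !mul1r mulr1 /B -mulrA [Mq * _]mulrC !normrM.
  rewrite ler_pM ?mulr_ge0//; first by apply: pM; rewrite in_itv/= x1 x2.
  rewrite ler_pM//; last by apply: qM; rewrite in_itv/= y1 y2.
  rewrite ger0_norm ?powR_ge0//; apply: le0_ger_powR.
  + by rewrite subr_le0.
  + by rewrite mulr_gt0//; lra.
  + by rewrite lerDl subr_ge0.
- move=> x; rewrite in_itv/= => /andP[x1 x2].
  have x0 : 0 <= 1 + x by lra.
  rewrite /B opprK powRM ?(ltW rho_gt0)// mulrA -[leLHS]mulrA ler_wpM2l//.
    by rewrite !mulr_ge0// powR_ge0.
  rewrite mulrC mulr_powRB1//; apply: ge0_ler_powR; rewrite ?nnegrE//.
    exact: ltW.
  by lra.
Qed.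

(** Here the short slices are those at y: the bound (1 - y)^(alpha - 1) holds on
the segment [-1, - y], of length 1 - y. *)
Let integrable_h_lt0 : (mu \x mu)%E.-integrable setT (EFin \o h `]-oo, 0[).
Proof.
have ab : -1 <= 1 :> R by lra.
have [Mp Mp0 pM] := continuous_itv_bounded ab cp.
have [Mq Mq0 qM] := continuous_itv_bounded ab cq.
pose B (y : R) := Mp * Mq * (1 - y) `^ (alpha - 1).
have B0 x : 0 <= B x by rewrite !mulr_ge0// powR_ge0.
apply: (@integrable_bounded_slices2 _ _ (fun=> -1) (fun y => - y) B (-1) 1
  (Mp * Mq * 2 `^ alpha)) => //.
- exact: measurable_h.
- move=> y y1 x; rewrite /h/= indicE [X in _ * (X * _)]indicE !mem_setE.
  by rewrite (negbTE y1) mul0r mulr0.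
- by move=> x; rewrite in_itv/=; lra.
- move=> y; rewrite in_itv/= => /andP[y1 y2] x.
  rewrite /h/= !indicE !mem_setE !in_itv/=.
  have [xm|] := ltP (-1) x; last by rewrite mul0r normr0 mulr_ge0.
  have [xy|xy] := ltP (x + y) 0; last by rewrite mul0r !mulr0 normr0 mulr_ge0.
  have [x2|] := leP x 1; last by rewrite mul0r normr0 mulr_ge0.
  rewrite y1 y2 (ltW xm) (_ : x <= - y); last by lra.
  rewrite !mul1r mulr1 /B -mulrA [Mq * _]mulrC !normrM.
  rewrite ler_pM ?mulr_ge0//; first by apply: pM; rewrite in_itv/= (ltW xm) x2.
  rewrite ler_pM//; last by apply: qM; rewrite in_itv/= y1 y2.
  rewrite ger0_norm ?powR_ge0//; apply: le0_ger_powR.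
  + by rewrite subr_le0.
  + by lra.
  + by rewrite lerDr mulr_ge0 ?(ltW rho_gt0)//; lra.
- move=> y; rewrite in_itv/= => /andP[y1 y2].
  have y0 : 0 <= 1 - y by lra.
  rewrite /B -[leLHS]mulrA ler_wpM2l ?mulr_ge0// opprK [- y + 1]addrC.
  rewrite mulrC mulr_powRB1//; apply: ge0_ler_powR; rewrite ?nnegrE//.
    exact: ltW.
  by lra.
Qed.

Let slice_h1 (I : set R) (x : R) : \int[mu]_y h I (x, y) =
  \1_(`]-1, 1] : set R) x * (p x *
    \int[mu]_(y in `[-1, 1] `&` [set y | I (x + y)]) (K x y * q y)).
Proof.
rewrite [in RHS]Rintegral_mkcond -!RintegralZl_nonmeasurable.
apply: eq_Rintegral => y _; rewrite patchE in_setI /h/=.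
have -> : (y \in [set y | I (x + y)]) = (x + y \in I).
  by apply/idP/idP; rewrite !inE.
by rewrite [\1_`[-1, 1] y]indicE [\1_I _]indicE;
  case: (y \in _); case: (_ \in _); rewrite /= ?mul1r ?mul0r ?mulr0.
Qed.

Let slice_h2 (I : set R) (y : R) : \int[mu]_x h I (x, y) =
  \1_(`[-1, 1] : set R) y * (q y *
    \int[mu]_(x in `]-1, 1] `&` [set x | I (x + y)]) (K x y * p x)).
Proof.
rewrite [in RHS]Rintegral_mkcond -!RintegralZl_nonmeasurable.
apply: eq_Rintegral => x _; rewrite patchE in_setI /h/=.
have -> : (x \in [set x | I (x + y)]) = (x + y \in I).
  by apply/idP/idP; rewrite !inE.
rewrite [\1_`]-1, 1] x]indicE [\1_I _]indicE.
case: (x \in _); case: (_ \in _) => /=; first by ring.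
all: by rewrite ?mul0r ?mulr0 // mul0r mulr0.
Qed.

Let slice_h_ge0 (x : R) : -1 < x -> x <= 1 ->
  \int[mu]_y h `[0, +oo[ (x, y) = p x * \int[mu]_(y in `[- x, 1]) (K x y * q y).
Proof.
move=> x1 x2; rewrite slice_h1 indicE mem_set/= ?in_itv/= ?x1// mul1r.
congr (_ * _); congr (Rintegral _ _ _); apply/seteqP; split => y /=;
  rewrite !in_itv/= ?andbT.
  by move=> [/andP[_ ->]]; rewrite andbT; lra.
by move=> /andP[xy ->]; rewrite andbT; split; lra.
Qed.

Let slice_h_lt0 (x : R) : -1 < x -> x <= 1 ->
  \int[mu]_y h `]-oo, 0[ (x, y) =
  p x * \int[mu]_(y in `[-1, - x[) (K x y * q y).
Proof.
move=> x1 x2; rewrite slice_h1 indicE mem_set/= ?in_itv/= ?x1// mul1r.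
congr (_ * _); congr (Rintegral _ _ _); apply/seteqP; split => y /=;
  rewrite !in_itv/= ?andbT.
  by move=> [/andP[-> _]]; lra.
by move=> /andP[-> xy]; split; lra.
Qed.

Let integral_h_ge0 : \int[mu]_x \int[mu]_y h `[0, +oo[ (x, y) =
  \int[mu]_(x in `[-1, 1])
    ((1 + x) `^ alpha * p x *
     \int[mu]_(z in `[0, 1]) ((rho + z) `^ (alpha - 1) * q (1 - z * (1 + x)))).
Proof.
rewrite [RHS]Rintegral_mkcond; apply: eq_Rintegral => x _.
rewrite patchE mem_setE in_itv/=; have [x1|x1] := ltP (-1) x; last first.
  rewrite slice_h1 indicE mem_setE in_itv/= ltNge x1/= mul0r.
  (* at x = -1 the right-hand side vanishes through 0 `^ alpha = 0 *)
  case: ifPn => // /andP[x2 _]; have -> : x = -1 by lra.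
  by rewrite subrr powR0 ?gt_eqF// !mul0r.
rewrite (ltW x1)/=; case: ifPn => x2.
  by rewrite slice_h_ge0// scaled_slice1// mulrA [p x * _]mulrC.
by rewrite slice_h1 indicE mem_setE in_itv/= (negbTE x2) andbF mul0r.
Qed.

Let integral_h_lt0 : \int[mu]_y \int[mu]_x h `]-oo, 0[ (x, y) =
  \int[mu]_(y in `[-1, 1])
    ((1 - y) `^ alpha * q y *
     \int[mu]_(z in `[0, 1]) ((rho * z + 1) `^ (alpha - 1) *
       p (z * (1 - y) - 1))).
Proof.
rewrite [RHS]Rintegral_mkcond; apply: eq_Rintegral => y _.
rewrite slice_h2 patchE indicE; case: ifPn => [|_]; last by rewrite mul0r.
rewrite mem_setE in_itv/= => /andP[y1]; rewrite le_eqVlt => /predU1P[->|y2].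
  rewrite subrr powR0 ?gt_eqF// !mul0r mul1r.
  rewrite (_ : _ `&` _ = set0) ?Rintegral_set0 ?mulr0//.
  by rewrite -subset0 => x /=; rewrite !in_itv/=; lra.
rewrite mul1r (_ : _ `&` _ = `]-1, - y[%classic); last first.
  by apply/seteqP; split => x /=; rewrite !in_itv/=; [|split]; lra.
have iK : mu.-integrable `[-1, - y] (EFin \o (fun x => K x y * p x)).
  apply: continuous_compact_integrable; first exact: segment_compact.
  exact: continuous_slice2.
rewrite Rintegral_itv_obnd_cbnd; last first.
  by apply: integrableS iK => //; exact: subset_itv_oo_cc.
rewrite Rintegral_itv_bndo_bndc; last first.
  by apply: integrableS iK => //; exact: subset_itv_co_cc.
by rewrite scaled_slice2// mulrA [q y * _]mulrC.
Qed.

(** In the triangle above the diagonal, the inner integral is already in the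
variable y in which the rescaling is done; in the other one, the integrals are
exchanged first.  The slice at x = -1, on which the kernel may be unbounded, is
removed from the left-hand side, so that the other ones can be split by mere
continuity. *)
Lemma Rintegral_Duffy :
  \int[mu]_(x in `[-1, 1])
    (p x * \int[mu]_(y in `[-1, 1])
      ((rho * (1 + x) + (1 - y)) `^ (alpha - 1) * q y)) =
  \int[mu]_(x in `[-1, 1])
    ((1 + x) `^ alpha * p x *
     \int[mu]_(z in `[0, 1])
       ((rho + z) `^ (alpha - 1) * q (1 - z * (1 + x)))) +
  \int[mu]_(y in `[-1, 1])
    ((1 - y) `^ alpha * q y *
     \int[mu]_(z in `[0, 1])
       ((rho * z + 1) `^ (alpha - 1) * p (z * (1 - y) - 1))).
Proof.
rewrite -integral_h_ge0 -integral_h_lt0 -(Rintegral_Fubini integrable_h_lt0).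
have i1 := integrable_Rintegral_prod1 integrable_h_ge0.
have i2 := integrable_Rintegral_prod1 integrable_h_lt0.
pose S x := \int[mu]_y h `[0, +oo[ (x, y) + \int[mu]_y h `]-oo, 0[ (x, y).
have SE (x : R) : x \in `]-1, 1] ->
    S x = p x * \int[mu]_(y in `[-1, 1]) (K x y * q y).
  rewrite in_itv/= => /andP[x1 x2]; rewrite /S slice_h_ge0// slice_h_lt0//.
  rewrite -mulrDr addrC; congr (_ * _).
  have xU : (`[-1, - x[ `|` `[- x, 1])%classic = `[-1, 1]%classic :> set R.
    by rewrite -itv_bndbnd_setU//= bnd_simp; lra.
  rewrite -xU Rintegral_setU//; last 2 first.
  - rewrite xU; apply: continuous_compact_integrable.
      exact: segment_compact.
    exact: continuous_slice1.
  - by apply/disj_setPS => y [] /=; rewrite !in_itv/=; lra.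
have iS : mu.-integrable setT (EFin \o S).
  have := integrableD measurableT i1 i2; exact: eq_integrable.
rewrite -(RintegralD measurableT i1 i2) -/S.
rewrite -[LHS]Rintegral_itv_obnd_cbnd; last first.
  apply: eq_integrable (integrableS _ _ (@subsetT _ _) iS) => // x.
  by rewrite mem_setE => x1 /=; rewrite SE.
rewrite Rintegral_mkcond; apply: eq_Rintegral => x _; rewrite patchE mem_setE.
case: ifPn => [x1|x1]; first by rewrite -SE.
by rewrite !slice_h1 !indicE mem_setE (negbTE x1) !mul0r addr0.
Qed.

End singular_kernel.

(** * The kernel on adjacent subintervals *)

Section reference_element.
Context {R : realType}.
Variables (t : nat -> R).

Lemma Psi_horner (r : nat -> nat) (psi : forall n, (r n).-tuple {poly_(r n) R})
    n (j : 'I_(r n)) :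
  exists P : {poly R}, Psi t psi n j = horner P.
Proof.
exists (polyn (tnth (psi n) j) \Po
  ((t n - t n.-1) / 2 *: 'X + ((t n.-1 + t n) / 2)%:P)).
apply/funext => tau; rewrite horner_comp !hornerE /Psi /tmap.
by congr _.[_]; field.
Qed.

(** The two midpoints are half of each step away from the common node, so that
2 D = k + k'. *)
Lemma Delta_adjacent n tau sigma (rho := step t n / step t (n - 1)%N) :
  step t (n - 1)%N != 0 -> 1 + rho != 0 ->
  1 + Delta t n 1 tau sigma = (rho * (1 + tau) + (1 - sigma)) / (1 + rho).
Proof.
move=> k0 rho0; have DE : 2 * Dmid t n 1 = step t (n - 1)%N * (1 + rho).
  rewrite [in RHS]mulrDr mulr1 [_ * rho]mulrC divfK//.
  by rewrite /Dmid /midpoint /step subn1; field.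
rewrite /Delta DE {1}(_ : step t n = rho * step t (n - 1)%N); last first.
  by rewrite /rho divfK.
by field; rewrite rho0 k0.
Qed.

End reference_element.

Theorem lemma5 (R : realType) (alpha : R) (halpha : 0 < alpha < 1)
    (N : nat) (T : R) (t : nat -> R) (ht0 : t 0%N = 0) (htN : t N = T)
    (ht : forall m : nat, (m < N)%N -> t m < t m.+1)
    (r : nat -> nat) (hr : forall m : nat, (1 <= m <= N)%N -> (1 <= r m)%N)
    (psi : forall m : nat, (r m).-tuple {poly_(r m) R})
    (hpsi : forall m : nat, (1 <= m <= N)%N -> basis_of fullv (psi m))
    (n : nat) (hn : (2 <= n <= N)%N)
    (i : 'I_(r n)) (j : 'I_(r (n - 1)%N)) :
  let rho := step t n / step t (n - 1)%N in
  [/\ calA alpha t psi n 1 j =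
        (1 + rho) `^ (1 - alpha) *
        \int[lebesgue_measure]_(sigma in `[-1, 1])
          ((2 * rho + 1 - sigma) `^ (alpha - 1) * Psi t psi (n - 1)%N j sigma),
      calB alpha t psi n 1 j =
        (1 + rho) `^ (1 - alpha) *
        \int[lebesgue_measure]_(sigma in `[-1, 1])
          ((1 - sigma) `^ (alpha - 1) * Psi t psi (n - 1)%N j sigma)
    & calC alpha t psi n 1 i j =
        (1 + rho) `^ (1 - alpha) *
        (\int[lebesgue_measure]_(tau in `[-1, 1])
           ((1 + tau) `^ alpha * derive1 (Psi t psi n i) tau *
            \int[lebesgue_measure]_(z in `[0, 1])
              ((rho + z) `^ (alpha - 1) *
               Psi t psi (n - 1)%N j (1 - z * (1 + tau)))) +
         \int[lebesgue_measure]_(sigma in `[-1, 1])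
           ((1 - sigma) `^ alpha * Psi t psi (n - 1)%N j sigma *
            \int[lebesgue_measure]_(z in `[0, 1])
              ((rho * z + 1) `^ (alpha - 1) *
               derive1 (Psi t psi n i) (z * (1 - sigma) - 1))))].

Proof.
move=> rho.
have [n2 nN] := andP hn; have [a0 a1] := andP halpha.
have step_gt0 (m : nat) : (0 < m <= N)%N -> 0 < step t m.
  by case: m => // m /= mN; rewrite /step subr_gt0 ht.
have kn : 0 < step t n by apply: step_gt0; rewrite nN (ltn_trans _ n2).
have kp : 0 < step t (n - 1)%N.
  by apply: step_gt0; rewrite subn_gt0 n2 (leq_trans (leq_subr _ _)).
have rho0 : 0 < rho by rewrite divr_gt0.
have rho1 : 0 < 1 + rho by rewrite addr_gt0.
have kernelE (tau sigma : R) : -1 <= tau -> sigma <= 1 ->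
    (1 + Delta t n 1 tau sigma) `^ (alpha - 1) =
    (1 + rho) `^ (1 - alpha) * (rho * (1 + tau) + (1 - sigma)) `^ (alpha - 1).
  move=> tau1 sigma1; rewrite Delta_adjacent ?gt_eqF//.
  rewrite powRM ?invr_ge0 ?(ltW rho1)//.
    by rewrite mulrC -powR_inv1 ?(ltW rho1)// -powRrM mulN1r opprB.
  by rewrite addr_ge0 ?subr_ge0// mulr_ge0 ?(ltW rho0)//; lra.
have [P PE] := Psi_horner t psi i; have [Q QE] := Psi_horner t psi j.
split.
- rewrite /calA -RintegralZl_nonmeasurable; apply: eq_Rintegral => s /set_mem/=.
  rewrite in_itv/= => /andP[_ s1]; rewrite kernelE// -[LHS]mulrA.
  by congr (_ * (_ `^ _ * _)); ring.
- rewrite /calB -RintegralZl_nonmeasurable; apply: eq_Rintegral => s /set_mem/=.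
  rewrite in_itv/= => /andP[_ s1]; rewrite kernelE// -[LHS]mulrA.
  by congr (_ * (_ `^ _ * _)); ring.
rewrite /calC PE QE -derivE -Rintegral_Duffy ?ltW//; last 2 first.
- exact: continuous_horner.
- exact: continuous_horner.
rewrite -RintegralZl_nonmeasurable; apply: eq_Rintegral => s /set_mem/=.
rewrite in_itv/= => /andP[s1 _]; rewrite [RHS]mulrCA.
congr (_ * _); rewrite -RintegralZl_nonmeasurable.
apply: eq_Rintegral => y /set_mem/=.
by rewrite in_itv/= => /andP[_ y1]; rewrite kernelE// -[LHS]mulrA.
Qed.
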